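(* Let $C_9\approx0.4870156430$ be the smallest positive root of $3072x^5+9304x^4-35096x^3+40708x^2-25350x+6137$. For every triangle, the following bounds hold, where a bound $L\le \frac{D(n,i)}{D(n,j)}\le U$ means $L\,D(n,j)\le D(n,i)\le U\,D(n,j)$ (and similarly for one-sided bounds and equalities): $$\frac32\le\frac{D(9,1)}{D(9,2)}\le3,\quad \frac{D(9,1)}{D(9,4)}\le1,\quad \frac{D(9,1)}{D(9,5)}\le2,\quad \frac23\le\frac{D(9,1)}{D(9,6)}\le1,\quad \frac12\le\frac{D(9,1)}{D(9,7)}\le1,\quad 1\le\frac{D(9,1)}{D(9,8)},\quad 2\le\frac{D(9,1)}{D(9,10)},$$ $$\frac{D(9,2)}{D(9,4)}\le\frac13,\quad \frac{D(9,2)}{D(9,5)}\le\frac23,\quad \frac14\le\frac{D(9,2)}{D(9,6)}\le\frac12,\quad \frac{D(9,2)}{D(9,7)}=\frac13,\quad \frac13\le\frac{D(9,2)}{D(9,8)},\quad \frac43\le\frac{D(9,2)}{D(9,10)},$$ $$\frac{D(9,3)}{D(9,4)}\le\frac12,\quad \frac{D(9,3)}{D(9,5)}\le2,\quad 1\le\frac{D(9,3)}{D(9,10)},$$ $$2\le\frac{D(9,4)}{D(9,5)}\le4,\quad 1\le\frac{D(9,4)}{D(9,6)},\quad 1\le\frac{D(9,4)}{D(9,7)},\quad 1\le\frac{D(9,4)}{D(9,8)},\quad 10\le\frac{D(9,4)}{D(9,10)},$$ $$C_9\le\frac{D(9,5)}{D(9,6)},\quad \frac12\le\frac{D(9,5)}{D(9,7)},\quad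 \frac12\le\frac{D(9,5)}{D(9,8)},\quad \frac52+\sqrt2\le\frac{D(9,5)}{D(9,10)},$$ $$\frac23\le\frac{D(9,6)}{D(9,7)}\le\frac43,\quad 1\le\frac{D(9,6)}{D(9,8)},\quad \frac83\le\frac{D(9,6)}{D(9,10)},\quad 1\le\frac{D(9,7)}{D(9,8)},\quad 4\le\frac{D(9,7)}{D(9,10)}.$$
   Context: For a (nondegenerate) triangle $ABC$ with side lengths $a=BC$, $b=CA$, $c=AB$, a point with barycentric coordinates $(u:v:w)$ is $(uA+vB+wC)/(u+v+w)$. For $1\le n\le 10$ the triangle center $X_n$ is the point with barycentric coordinates $(f_n(a,b,c):f_n(b,c,a):f_n(c,a,b))$, where $f_1=a$ (incenter); $f_2=1$ (centroid); $f_3=a^2(a^2-b^2-c^2)$ (circumcenter); $f_4=(a^2+b^2-c^2)(a^2-b^2+c^2)$ (orthocenter); $f_5=c^4-a^2b^2+b^4-a^2c^2-2b^2c^2$ (nine-point center); $f_6=a^2$ (symmedian point); $f_7=(a+b-c)(a-b+c)$ (Gergonne point); $f_8=a-b-c$ (Nagel point); $f_9=a(a-b-c)$ (mittenpunkt); $f_{10}=b+c$ (Spieker center). $D(i,j)$ denotes the Euclidean distance between $X_i$ and $X_j$. *)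

(* Defs.v *)
From Stdlib Require Export Reals.
Open Scope R_scope.

Definition point : Type := (R * R)%type.

Definition pdist (P Q : point) : R := dist_euc (fst P) (snd P) (fst Q) (snd Q).

Definition twice_signed_area (A B C : point) : R :=
  (fst B - fst A) * (snd C - snd A) - (fst C - fst A) * (snd B - snd A).

Record Triangle : Type := MkTriangle {
  vA : point;
  vB : point;
  vC : point;
  nondegenerate : twice_signed_area vA vB vC <> 0
}.

Definition barycentric (T : Triangle) (u v w : R) : point :=
  ((u * fst (vA T) + v * fst (vB T) + w * fst (vC T)) / (u + v + w),
   (u * snd (vA T) + v * snd (vB T) + w * snd (vC T)) / (u + v + w)).

(* The value 0 for n outside 1..10 is a filler; no such index is meant to be
   used. *)
Definition center_function (n : nat) (a b c : R) : R :=
  match n with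
  | 1%nat => a                                               (* incenter *)
  | 2%nat => 1                                               (* centroid *)
  | 3%nat => a^2 * (a^2 - b^2 - c^2)                         (* circumcenter *)
  | 4%nat => (a^2 + b^2 - c^2) * (a^2 - b^2 + c^2)           (* orthocenter *)
  | 5%nat => c^4 - a^2 * b^2 + b^4 - a^2 * c^2 - 2 * b^2 * c^2
                                                             (* nine-point center *)
  | 6%nat => a^2                                             (* symmedian point *)
  | 7%nat => (a + b - c) * (a - b + c)                       (* Gergonne point *)
  | 8%nat => a - b - c                                       (* Nagel point *)
  | 9%nat => a * (a - b - c)                                 (* mittenpunkt *)
  | 10%nat => b + c                                          (* Spieker center *)
  | _ => 0
  end.

Definition X (T : Triangle) (n : nat) : point :=
  let a := pdist (vB T) (vC T) in
  let b := pdist (vC T) (vA T) in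
  let c := pdist (vA T) (vB T) in
  barycentric T (center_function n a b c)
                (center_function n b c a)
                (center_function n c a b).

Definition D (T : Triangle) (i j : nat) : R := pdist (X T i) (X T j).

Definition smallest_positive_root (p : R -> R) (r : R) : Prop :=
  0 < r /\ p r = 0 /\ forall x : R, 0 < x -> p x = 0 -> r <= x.

Definition quintic (x : R) : R :=
  3072 * x^5 + 9304 * x^4 - 35096 * x^3 + 40708 * x^2 - 25350 * x + 6137.

(* Main.v *)
(* Ravi's substitution a = y + z, b = z + x, c = x + y (x, y, z > 0) makes
   each squared distance D(9,n)^2 a rational function of the elementary
   symmetric functions p, q, r of x, y, z, so every bound becomes a symmetric
   polynomial inequality in x, y, z.  Assuming x <= y <= z and writing y = x + s,
   z = x + s + t, almost all of them become polynomials in x, s, t with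
   nonnegative coefficients, or follow from such ones by chaining.  The two
   sharp constants C9 and 5/2 + sqrt 2 are attained at non-equilateral
   isosceles triangles; there one first subtracts a term that is manifestly
   nonnegative, vanishes at the extremal triangle and agrees with the polynomial
   on isosceles triangles, and the difference again has nonnegative
   coefficients. *)
Require Import Defs.
From Stdlib Require Import Lra Lia.
Open Scope R_scope.

(** * Distances, the triangle inequality and barycentric coordinates *)

Lemma pdist_nonneg (P Q : point) : 0 <= pdist P Q.
Proof. apply sqrt_pos. Qed.

Lemma pdist_sq (P Q : point) :
  pdist P Q ^ 2 = (fst P - fst Q) ^ 2 + (snd P - snd Q) ^ 2.
Proof.
  unfold pdist, dist_euc. rewrite pow2_sqrt; [unfold Rsqr; ring|].
  pose proof (Rle_0_sqr (fst P - fst Q)).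
  pose proof (Rle_0_sqr (snd P - snd Q)). lra.
Qed.

(** Lagrange's identity makes Cauchy-Schwarz strict: the defect of [dot ^ 2] is the squared signed
    area. The law of cosines does the rest. *)
Lemma pdist_triangle_strict (P Q S : point) :
  twice_signed_area P Q S <> 0 -> pdist Q S < pdist S P + pdist P Q.
Proof.
  intros harea.
  pose proof (pdist_nonneg Q S). pose proof (pdist_nonneg S P) as hb.
  pose proof (pdist_nonneg P Q) as hc.
  pose proof (pdist_sq Q S) as ea. pose proof (pdist_sq S P) as eb.
  pose proof (pdist_sq P Q) as ec.
  set (dot := (fst Q - fst P) * (fst S - fst P)
              + (snd Q - snd P) * (snd S - snd P)).
  assert (hdot : dot ^ 2 < (pdist S P * pdist P Q) ^ 2).
  { rewrite Rpow_mult_distr, eb, ec. unfold dot.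
    pose proof (Rsqr_pos_lt _ harea) as h.
    unfold Rsqr, twice_signed_area in h. nra. }
  assert (hlt : - (pdist S P * pdist P Q) < dot).
  { assert (0 <= pdist S P * pdist P Q) by now apply Rmult_le_pos.
    nra. }
  assert (pdist Q S ^ 2 = pdist S P ^ 2 + pdist P Q ^ 2 - 2 * dot)
    by (rewrite ea, eb, ec; unfold dot; ring).
  nra.
Qed.

(** The normalized weights differ by a triple of sum zero, whose squared length depends only on the
    side lengths. The totals [s], [s'] are separate arguments so that they can be supplied in terms
    of p, q, r. *)
Lemma pdist_barycentric_sq (T : Triangle) (u v w s u' v' w' s' : R) :
  s <> 0 -> s' <> 0 -> u + v + w = s -> u' + v' + w' = s' ->
  pdist (barycentric T u v w) (barycentric T u' v' w') ^ 2 =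
  - (pdist (vB T) (vC T) ^ 2 * (v / s - v' / s') * (w / s - w' / s')
     + pdist (vC T) (vA T) ^ 2 * (w / s - w' / s') * (u / s - u' / s')
     + pdist (vA T) (vB T) ^ 2 * (u / s - u' / s') * (v / s - v' / s')).
Proof.
  intros h h' e e'. rewrite !pdist_sq. unfold barycentric; cbn [fst snd].
  subst s s'. field; auto.
Qed.

(** * Distances from the mittenpunkt in terms of p, q, r *)

Definition weight_sum (n : nat) (p q r : R) : R :=
  match n with
  | 1%nat => 2*p
  | 2%nat => 3
  | 3%nat => -16*p*r
  | 4%nat => 16*p*r
  | 5%nat => -32*p*r
  | 6%nat => 2*(p^2 - q)
  | 7%nat => 4*q
  | 8%nat => -2*p
  | 9%nat => -4*q
  | 10%nat => 4*p
  | _ => 0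
  end.

Lemma center_function_sum (n : nat) (x y z : R) :
  center_function n (y + z) (z + x) (x + y)
  + center_function n (z + x) (x + y) (y + z)
  + center_function n (x + y) (y + z) (z + x)
  = weight_sum n (x + y + z) (x*y + y*z + z*x) (x*y*z).
Proof.
  do 11 try destruct n as [|n]; unfold center_function, weight_sum; ring.
Qed.

Lemma weight_sum_neq0 (n : nat) (p q r : R) :
  (1 <= n <= 10)%nat -> 0 < p -> 0 < q -> 0 < r -> q < p^2 ->
  weight_sum n p q r <> 0.
Proof.
  intros hn hp hq hr hpq. assert (0 < p*r) by now apply Rmult_lt_0_compat.
  do 11 try destruct n as [|n]; try lia; unfold weight_sum; nra.
Qed.

(* 64 p q^2 r D(9,n)^2 *)
Definition scaled_sq (n : nat) (p q r : R) : R :=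
  let n1 := p^3*q^2 + 2*p^2*q*r - 4*p*q^3 - 3*p*r^2 + 4*q^2*r in
  let n2 := p^2*q^2 + 6*p*q*r - 4*q^3 - 27*r^2 in
  match n with
  | 1%nat => 16*r*n1
  | 2%nat => 16/9*p*r*n2
  | 3%nat => 4*(p^2*q^4 - 4*p^3*q^2*r + 16*p^2*q*r^2 - 2*p*q^3*r - 12*p*r^3
                + q^2*r^2)
  | 4%nat => 16*(p*q + r)^2*(q^2 - 3*p*r)
  | 5%nat => p^2*q^4 - 16*p^2*q*r^2 - 2*p*q^3*r - 48*p*r^3 + q^2*r^2
  | 6%nat => 16*r*n1*p^4/(p^2 - q)^2
  | 7%nat => 16*p*r*n2
  | 8%nat => 16*r*(p^3*q^2 - 2*p^2*q*r - 4*p*q^3 - 3*p*r^2 + 16*q^2*r)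
  | 10%nat => 16*r^2*(q^2 - 3*p*r)
  | _ => 0
  end.

Lemma D9_scaled_sq (T : Triangle) (x y z : R) :
  0 < x -> 0 < y -> 0 < z ->
  pdist (vB T) (vC T) = y + z -> pdist (vC T) (vA T) = z + x ->
  pdist (vA T) (vB T) = x + y ->
  let p := x + y + z in let q := x*y + y*z + z*x in let r := x*y*z in
  forall n : nat, (1 <= n <= 10)%nat -> n <> 9%nat ->
  64*p*q^2*r * D T 9 n ^ 2 = scaled_sq n p q r.
Proof.
  intros hx hy hz ea eb ec p q r n hn hn9.
  assert (hxy : 0 < x*y) by now apply Rmult_lt_0_compat.
  assert (hyz : 0 < y*z) by now apply Rmult_lt_0_compat.
  assert (hzx : 0 < z*x) by now apply Rmult_lt_0_compat.
  assert (hp : 0 < p) by (unfold p; lra).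
  assert (hq : 0 < q) by (unfold q; lra).
  assert (hr : 0 < r) by now apply Rmult_lt_0_compat.
  assert (hpq : q < p^2) by (unfold p, q; nra).
  unfold D, X; rewrite ea, eb, ec.
  rewrite (pdist_barycentric_sq T _ _ _ (weight_sum 9 p q r)
             _ _ _ (weight_sum n p q r));
    [|apply weight_sum_neq0; auto; lia..
     |apply center_function_sum|apply center_function_sum].
  rewrite ea, eb, ec.
  assert (hp0 : p <> 0) by lra. assert (hq0 : q <> 0) by lra.
  assert (hr0 : r <> 0) by lra. assert (hpq0 : p^2 - q <> 0) by lra.
  unfold p, q, r in *.
  do 11 try destruct n as [|n]; try lia;
    unfold center_function, scaled_sq, weight_sum; cbv zeta.
  all: field; repeat split; try assumption; now apply Rgt_not_eq.
Qed.

(** * Reduction to ordered variables and nonnegative coefficients *)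

Lemma sorted_wlog (P : R -> R -> R -> Prop) :
  (forall x s t, 0 < x -> 0 <= s -> 0 <= t ->
     let y := x + s in let z := x + s + t in
     P (x + y + z) (x*y + y*z + z*x) (x*y*z)) ->
  forall x y z, 0 < x -> 0 < y -> 0 < z ->
  P (x + y + z) (x*y + y*z + z*x) (x*y*z).
Proof.
  intros hs.
  assert (hle : forall x y z, 0 < x -> x <= y -> y <= z ->
            P (x + y + z) (x*y + y*z + z*x) (x*y*z)).
  { intros x y z hx hxy hyz.
    specialize (hs x (y - x) (z - y)); cbv zeta in hs.
    replace (x + (y - x) + (z - y)) with z in hs by ring.
    replace (x + (y - x)) with y in hs by ring.
    apply hs; lra. }
  (* The two adjacent transpositions generate all orderings of the variables. *)
  assert (h12 : forall x y z, P (x + y + z) (x*y + y*z + z*x) (x*y*z) ->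
            P (y + x + z) (y*x + x*z + z*y) (y*x*z)).
  { intros x y z h.
    replace (y + x + z) with (x + y + z) by ring.
    replace (y*x + x*z + z*y) with (x*y + y*z + z*x) by ring.
    now replace (y*x*z) with (x*y*z) by ring. }
  assert (h23 : forall x y z, P (x + y + z) (x*y + y*z + z*x) (x*y*z) ->
            P (x + z + y) (x*z + z*y + y*x) (x*z*y)).
  { intros x y z h.
    replace (x + z + y) with (x + y + z) by ring.
    replace (x*z + z*y + y*x) with (x*y + y*z + z*x) by ring.
    now replace (x*z*y) with (x*y*z) by ring. }
  intros x y z hx hy hz.
  destruct (Rle_lt_dec x y); destruct (Rle_lt_dec y z); destruct (Rle_lt_dec x z);
    first [ apply hle; lra | apply h12, hle; lra | apply h23, hle; lra
          | apply h12, h23, hle; lra | apply h23, h12, hle; lra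
          | apply h12, h23, h12, hle; lra ].
Qed.

Lemma le_of_sub_nonneg (a b : R) : 0 <= b - a -> a <= b.
Proof. lra. Qed.

Ltac nonneg_terms :=
  repeat match goal with
  | |- 0 <= _ + _ => apply Rplus_le_le_0_compat
  | |- 0 <= _ * _ => apply Rmult_le_pos
  | |- 0 <= _ ^ 2 => apply pow2_ge_0
  | |- 0 <= _ ^ _ => apply pow_le
  | |- 0 <= IZR _ => apply IZR_le; discriminate
  | |- _ => assumption
  end.

Ltac expand_nonneg := apply le_of_sub_nonneg; ring_simplify; nonneg_terms.

(* Factors p^4 and (p^2 - q)^2 stand for D(9,6) = p^2 / (p^2 - q) D(9,1): the
   points X_1, X_6, X_9 are collinear. *)
Definition expanding_bounds (p q r : R) : Prop :=
  scaled_sq 7 p q r <= 4 * scaled_sq 1 p q r /\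
  scaled_sq 1 p q r <= scaled_sq 7 p q r /\
  scaled_sq 8 p q r <= scaled_sq 1 p q r /\
  scaled_sq 7 p q r <= 4 * scaled_sq 5 p q r /\
  4*(p^2 - q)^2 * scaled_sq 7 p q r <= 9*p^4 * scaled_sq 1 p q r /\
  9*p^4 * scaled_sq 1 p q r <= 16*(p^2 - q)^2 * scaled_sq 7 p q r /\
  16 * scaled_sq 10 p q r <= scaled_sq 7 p q r /\
  4 * scaled_sq 3 p q r <= scaled_sq 4 p q r /\
  scaled_sq 3 p q r <= 4 * scaled_sq 5 p q r /\
  scaled_sq 10 p q r <= scaled_sq 3 p q r /\
  4 * scaled_sq 5 p q r <= scaled_sq 4 p q r /\
  scaled_sq 4 p q r <= 16 * scaled_sq 5 p q r /\
  p^4 * scaled_sq 1 p q r <= (p^2 - q)^2 * scaled_sq 4 p q r.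

Lemma expanding_bounds_hold (x y z : R) : 0 < x -> 0 < y -> 0 < z ->
  expanding_bounds (x + y + z) (x*y + y*z + z*x) (x*y*z).
Proof.
  revert x y z; apply sorted_wlog; intros x s t hx hs ht y z.
  apply Rlt_le in hx.
  unfold expanding_bounds, scaled_sq, y, z; clear y z.
  repeat split; expand_nonneg.
Qed.

(** * The two sharp constants *)

Lemma scaled_sq_10_5 (x y z : R) : 0 < x -> 0 < y -> 0 < z ->
  let p := x + y + z in let q := x*y + y*z + z*x in let r := x*y*z in
  (5/2 + sqrt 2)^2 * scaled_sq 10 p q r <= scaled_sq 5 p q r.
Proof.
  revert x y z.
  apply (sorted_wlog (fun p q r =>
    (5/2 + sqrt 2)^2 * scaled_sq 10 p q r <= scaled_sq 5 p q r)).
  intros x s t hx hs ht y z; cbv beta.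
  assert (hx' : 0 <= x) by lra.
  set (p := x + y + z); set (q := x*y + y*z + z*x); set (r := x*y*z).
  set (w := sqrt 2).
  assert (hw2 : w^2 = 2) by (apply pow2_sqrt; lra).
  assert (hw : 4/3 <= w <= 3/2).
  { assert (0 <= w) by apply sqrt_pos. nra. }
  (* E0 + w E1 is 4 S (N5 - (5/2 + w)^2 N10)
     - 4 g (S - 2 w x)^2 (B + 4 w x y z), N_n = scaled_sq n p q r, after
     reduction by w^2 = 2; being linear in w, it need only be bounded at
     w = 4/3 and w = 3/2.  The subtracted term vanishes at the isosceles triangle
     y = z = sqrt 2 x where the bound is attained. *)
  set (S := y + z). set (A := S^2 + 8*x^2).
  set (B := S*(2*x^2 + y*z) + 20*x*y*z).
  set (g := y^2*z^2*(y - x)*(z - x)).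
  set (E0 := S*(4*scaled_sq 5 p q r - 33*scaled_sq 10 p q r)
             - 4*g*(A*B - 32*S*x^2*y*z)).
  set (E1 := - 20*S*scaled_sq 10 p q r - 4*g*(4*A*x*y*z - 4*S*x*B)).
  assert (h43 : 0 <= 3*E0 + 4*E1).
  { unfold E0, E1, g, B, A, S, p, q, r, y, z, scaled_sq.
    ring_simplify; nonneg_terms. }
  assert (h32 : 0 <= 2*E0 + 3*E1).
  { unfold E0, E1, g, B, A, S, p, q, r, y, z, scaled_sq.
    ring_simplify; nonneg_terms. }
  assert (hE : 0 <= E0 + w*E1) by nra.
  assert (hS : 0 < S) by (unfold S, y, z; lra).
  assert (hg : 0 <= g*((S - 2*w*x)^2*(B + 4*w*(x*y*z)))).
  { assert (0 <= w) by lra. assert (0 <= y) by (unfold y; lra).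
    assert (0 <= z) by (unfold z; lra). assert (0 <= y - x) by (unfold y; lra).
    assert (0 <= z - x) by (unfold z; lra). assert (0 <= S) by lra.
    unfold g, B; nonneg_terms. }
  assert (hF : E0 + w*E1 + 4*(g*((S - 2*w*x)^2*(B + 4*w*(x*y*z))))
               = 4*S*(scaled_sq 5 p q r - (5/2 + w)^2*scaled_sq 10 p q r)).
  { replace ((S - 2*w*x)^2) with (A - 4*w*S*x + 4*(w^2 - 2)*x^2)
      by (unfold A; ring).
    replace ((5/2 + w)^2) with (33/4 + 5*w + (w^2 - 2)) by field.
    rewrite hw2.
    (* [E0] already holds the reduced form of the one product quadratic in [w], so the sides differ
       by a multiple of [2 - w^2]. *)
    transitivity (4*S*(scaled_sq 5 p q r - (33/4 + 5*w)*scaled_sq 10 p q r)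
                  + 64*g*S*x*(x*y*z)*(2 - w^2));
      [unfold E0, E1; field | rewrite hw2; ring]. }
  apply le_of_sub_nonneg, (Rmult_le_reg_l (4*S)); [lra|].
  rewrite Rmult_0_r, <- hF. lra.
Qed.

(* On the isosceles triangles x = y = 1, z = k the ratio D(9,5)/D(9,6) is
   (2k^2 + 5k + 1)(k^2 + 2k + 3) / (4k(k + 1)(k + 2)^2); up to the factor
   4(k + 2), the equation is the vanishing of the numerator of its
   derivative. *)
Lemma isosceles_quintic_root :
  exists k, 8 <= k <= 9 /\ k^5 = 4*k^4 + 32*k^3 + 46*k^2 + 21*k + 6.
Proof.
  destruct (IVT_cor (fun k => k^5 - (4*k^4 + 32*k^3 + 46*k^2 + 21*k + 6)) 8 9)
    as [k [hk e]]; [reg|lra|nra|].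
  exists k; split; [assumption|lra].
Qed.

Lemma quintic_decreasing (u v : R) :
  0 <= u -> u < v -> v <= 1/2 -> quintic v < quintic u.
Proof.
  intros hu huv hv.
  (* This is the divided difference [(quintic u - quintic v)/(v - u)]. The estimates below bound it
     from below by a positive quadratic in [u + v]. *)
  assert (h : 0 < 25350 - 40708*(u + v) + 35096*(u^2 + u*v + v^2)
                  - 9304*(u^3 + u^2*v + u*v^2 + v^3)
                  - 3072*(u^4 + u^3*v + u^2*v^2 + u*v^3 + v^4)).
  { assert (hu2 : u^2 <= 1/4) by nra. assert (hv2 : v^2 <= 1/4) by nra.
    assert (huv2 : u*v <= 1/4) by nra.
    assert (u^3 <= 1/8) by nra. assert (v^3 <= 1/8) by nra.
    assert (u^2*v <= 1/8) by nra. assert (u*v^2 <= 1/8) by nra.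
    assert (u^4 <= 1/16) by nra. assert (v^4 <= 1/16) by nra.
    assert (u^3*v <= 1/16) by nra. assert (u*v^3 <= 1/16) by nra.
    assert (u^2*v^2 <= 1/16) by nra.
    assert (3/4*(u + v)^2 <= u^2 + u*v + v^2) by nra.
    nra. }
  unfold quintic. nra.
Qed.

(** The constant is the value [N/M] of the isosceles ratio at its critical point [k]. The last
    clause says that it is the minimum of that ratio; the quintic arises by eliminating [k]. *)
Lemma C9_exists :
  exists C, smallest_positive_root quintic C /\
    Rabs (C - 0.4870156430) <= 5 / 10^11 /\ C <= 1/2 /\
    forall m z, 0 <= m -> 0 <= z ->
      C*(4*z*(z + m)*(z + 2*m)^2) <= (2*z^2 + 5*z*m + m^2)*(z^2 + 2*z*m + 3*m^2).
Proof.
  destruct isosceles_quintic_root as [k [hk ek]].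
  set (N := (2*k^2 + 5*k + 1)*(k^2 + 2*k + 3)).
  set (M := 4*k*(k + 1)*(k + 2)^2).
  assert (hN : 0 < N) by (unfold N; nra).
  assert (hM : 0 < M).
  { unfold M. apply Rmult_lt_0_compat; [nra|apply pow_lt; lra]. }
  assert (hNM : 2*N <= M) by (unfold N, M; nra).
  assert (hC0 : 0 < N/M) by now apply Rdiv_lt_0_compat.
  assert (hC1 : N/M <= 1/2).
  { apply (Rmult_le_reg_r M); [assumption|]. field_simplify; lra. }
  assert (hroot : quintic (N/M) = 0).
  { assert (hM5 : M^5 * quintic (N/M) = 0).
    { (* The resultant contains the critical-point equation squared. *)
      transitivity (16*(k^5 - (4*k^4 + 32*k^3 + 46*k^2 + 21*k + 6))^2
        * (1296 + 48582*k + 172278*k^2 - 175292*k^3 - 1591044*k^4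
           - 2823970*k^5 - 2490610*k^6 - 1267080*k^7 - 380720*k^8
           - 63264*k^9 - 4512*k^10)).
      - transitivity (6137*M^5 - 25350*N*M^4 + 40708*N^2*M^3 - 35096*N^3*M^2
                      + 9304*N^4*M + 3072*N^5).
        + unfold quintic; field; lra.
        + unfold N, M; ring.
      - rewrite ek; ring. }
    apply Rmult_integral in hM5 as [h|h]; [|assumption].
    apply (pow_nonzero M 5) in h; [contradiction|lra]. }
  exists (N/M); split; [|split; [|split]].
  - split; [assumption|split; [assumption|]].
    intros u hu eu. destruct (Rle_lt_dec (N/M) u) as [|hlt]; [assumption|].
    pose proof (quintic_decreasing u (N/M)). lra.
  (* The signs of [quintic] at the two ends of the interval enclose the root, by monotonicity on
     [0, 1/2]. *)
  - apply Rabs_le; split.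
    + destruct (Rle_lt_dec (0.4870156430 - 5/10^11) (N/M)) as [|hlt]; [lra|].
      pose proof (quintic_decreasing (N/M) (0.4870156430 - 5/10^11)) as h.
      assert (0 < quintic (0.4870156430 - 5/10^11)) by (unfold quintic; lra). lra.
    + destruct (Rle_lt_dec (N/M) (0.4870156430 + 5/10^11)) as [|hlt]; [lra|].
      pose proof (quintic_decreasing (0.4870156430 + 5/10^11) (N/M)) as h.
      assert (quintic (0.4870156430 + 5/10^11) < 0) by (unfold quintic; lra). lra.
  - assumption.
  - intros m z hm hz.
    set (P := (2*z^2 + 5*z*m + m^2)*(z^2 + 2*z*m + 3*m^2)).
    set (Q := 4*z*(z + m)*(z + 2*m)^2).
    (* P M - N Q has a double root at z = k m because k is critical. *)
    assert (h : k^3*(P*M - N*Q)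
      = (z - k*m)^2*(2*(M - 2*N)*k^3*z^2 + (k*(17*M - 16*N) + 6*M)*(z*m)
                     + 3*k*M*m^2)
        + 4*k*(k + 2)*(k^5 - (4*k^4 + 32*k^3 + 46*k^2 + 21*k + 6))
          *z^2*m*(z - k*m)) by (unfold P, Q, M, N; ring).
    rewrite ek, Rminus_diag, Rmult_0_r, !Rmult_0_l, Rplus_0_r in h.
    assert (0 <= P*M - N*Q).
    { apply (Rmult_le_reg_l (k^3)); [apply pow_lt; lra|].
      rewrite Rmult_0_r, h.
      assert (0 <= k) by lra. assert (0 <= M) by lra.
      assert (0 <= M - 2*N) by lra. assert (0 <= 17*M - 16*N) by lra.
      nonneg_terms. }
    apply (Rmult_le_reg_r M); [assumption|].
    replace (N/M*Q*M) with (N*Q) by (field; lra). lra.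
Qed.

(** With denominators cleared, this is [C] D(9,6) <= D(9,5); the second hypothesis is its isosceles
    case, from which the general one is deduced. *)
Lemma scaled_sq_6_5 (C : R) : 0 <= C <= 1/2 ->
  (forall m z, 0 <= m -> 0 <= z ->
     C*(4*z*(z + m)*(z + 2*m)^2)
     <= (2*z^2 + 5*z*m + m^2)*(z^2 + 2*z*m + 3*m^2)) ->
  forall x y z : R, 0 < x -> 0 < y -> 0 < z ->
  let p := x + y + z in let q := x*y + y*z + z*x in let r := x*y*z in
  C^2 * (p^4 * scaled_sq 1 p q r) <= (p^2 - q)^2 * scaled_sq 5 p q r.
Proof.
  intros hC hiso.
  apply (sorted_wlog (fun p q r =>
    C^2 * (p^4 * scaled_sq 1 p q r) <= (p^2 - q)^2 * scaled_sq 5 p q r)).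
  intros x s t hx hs ht y z; cbv beta.
  set (p := x + y + z); set (q := x*y + y*z + z*x); set (r := x*y*z).
  set (m := x + y); set (z2 := 2*z).
  set (P := (2*z2^2 + 5*z2*m + m^2)*(z2^2 + 2*z2*m + 3*m^2)).
  set (Q := 4*z2*(z2 + m)*(z2 + 2*m)^2).
  assert (hx' : 0 <= x) by lra.
  assert (hm : 0 <= m) by (unfold m, y; lra).
  assert (hz2 : 0 <= z2) by (unfold z2, z; lra).
  assert (hPQ : C^2*Q^2 <= P^2).
  { assert (0 <= Q) by (unfold Q; nonneg_terms).
    rewrite <- Rpow_mult_distr. apply pow_incr; split.
    - apply Rmult_le_pos; lra.
    - now apply hiso. }
  (* F0 - C^2 F1 compares the form of degree 14 at (2x, 2y, 2z) with its value
     at the isosceles point (x + y, x + y, 2z); it is linear in C^2. *)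
  set (F0 := 2^14*((p^2 - q)^2*scaled_sq 5 p q r) - 4*m^4*(z2 - m)^2*P^2).
  set (F1 := 2^14*(p^4*scaled_sq 1 p q r) - 4*m^4*(z2 - m)^2*Q^2).
  assert (h0 : 0 <= F0).
  { unfold F0, P, Q, z2, m, p, q, r, y, z, scaled_sq.
    ring_simplify; nonneg_terms. }
  assert (h1 : 0 <= 4*F0 - F1).
  { unfold F0, F1, P, Q, z2, m, p, q, r, y, z, scaled_sq.
    ring_simplify; nonneg_terms. }
  assert (hF : 0 <= F0 - C^2*F1).
  (* Interpolation between the endpoints [C^2 = 0] and [C^2 = 1/4], given by [h0] and [h1]. *)
  { replace (F0 - C^2*F1) with ((1 - 4*C^2)*F0 + C^2*(4*F0 - F1)) by ring.
    assert (C^2 <= 1/4) by nra.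
    assert (0 <= 1 - 4*C^2) by lra.
    nonneg_terms. }
  assert (hA : 0 <= 4*m^4*(z2 - m)^2*(P^2 - C^2*Q^2)).
  { assert (0 <= P^2 - C^2*Q^2) by lra. nonneg_terms. }
  apply le_of_sub_nonneg, (Rmult_le_reg_l (2^14)); [lra|].
  rewrite Rmult_0_r.
  replace (2^14 * _) with (F0 - C^2*F1 + 4*m^4*(z2 - m)^2*(P^2 - C^2*Q^2))
    by (unfold F0, F1; ring).
  lra.
Qed.

(** * Ravi's substitution and the assembly of the bounds *)

Lemma ravi (T : Triangle) : exists x y z,
  0 < x /\ 0 < y /\ 0 < z /\ pdist (vB T) (vC T) = y + z /\
  pdist (vC T) (vA T) = z + x /\ pdist (vA T) (vB T) = x + y.
Proof.
  pose proof (nondegenerate T) as h.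
  pose proof (pdist_triangle_strict (vA T) (vB T) (vC T)).
  pose proof (pdist_triangle_strict (vB T) (vC T) (vA T)) as hB.
  pose proof (pdist_triangle_strict (vC T) (vA T) (vB T)) as hC.
  assert (eB : twice_signed_area (vB T) (vC T) (vA T)
               = twice_signed_area (vA T) (vB T) (vC T))
    by (unfold twice_signed_area; ring).
  assert (eC : twice_signed_area (vC T) (vA T) (vB T)
               = twice_signed_area (vA T) (vB T) (vC T))
    by (unfold twice_signed_area; ring).
  rewrite eB in hB; rewrite eC in hC.
  set (a := pdist (vB T) (vC T)) in *. set (b := pdist (vC T) (vA T)) in *.
  set (c := pdist (vA T) (vB T)) in *.
  (* The tangent lengths from A, B, C to the incircle. *)
  exists ((b + c - a)/2), ((c + a - b)/2), ((a + b - c)/2).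
  repeat split; lra.
Qed.

Lemma le_of_scaled_sq (c k d e M N : R) :
  0 < c -> 0 <= e -> c*d^2 = M -> c*e^2 = N -> k^2*M <= N -> k*d <= e.
Proof.
  intros hc he <- <- h.
  apply Rsqr_incr_0_var; [|assumption]. unfold Rsqr.
  apply (Rmult_le_reg_l c); [assumption|]. lra.
Qed.

Theorem theorem9 :
  exists C9 : R,
    smallest_positive_root quintic C9 /\
    Rabs (C9 - 0.4870156430) <= 5 / 10^11 /\
    forall T : Triangle,
      (3/2 * D T 9 2 <= D T 9 1 <= 3 * D T 9 2) /\
      (D T 9 1 <= 1 * D T 9 4) /\
      (D T 9 1 <= 2 * D T 9 5) /\
      (2/3 * D T 9 6 <= D T 9 1 <= 1 * D T 9 6) /\
      (1/2 * D T 9 7 <= D T 9 1 <= 1 * D T 9 7) /\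
      (1 * D T 9 8 <= D T 9 1) /\
      (2 * D T 9 10 <= D T 9 1) /\
      (D T 9 2 <= 1/3 * D T 9 4) /\
      (D T 9 2 <= 2/3 * D T 9 5) /\
      (1/4 * D T 9 6 <= D T 9 2 <= 1/2 * D T 9 6) /\
      (D T 9 2 = 1/3 * D T 9 7) /\
      (1/3 * D T 9 8 <= D T 9 2) /\
      (4/3 * D T 9 10 <= D T 9 2) /\
      (D T 9 3 <= 1/2 * D T 9 4) /\
      (D T 9 3 <= 2 * D T 9 5) /\
      (1 * D T 9 10 <= D T 9 3) /\
      (2 * D T 9 5 <= D T 9 4 <= 4 * D T 9 5) /\
      (1 * D T 9 6 <= D T 9 4) /\
      (1 * D T 9 7 <= D T 9 4) /\
      (1 * D T 9 8 <= D T 9 4) /\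
      (10 * D T 9 10 <= D T 9 4) /\
      (C9 * D T 9 6 <= D T 9 5) /\
      (1/2 * D T 9 7 <= D T 9 5) /\
      (1/2 * D T 9 8 <= D T 9 5) /\
      ((5/2 + sqrt 2) * D T 9 10 <= D T 9 5) /\
      (2/3 * D T 9 7 <= D T 9 6 <= 4/3 * D T 9 7) /\
      (1 * D T 9 8 <= D T 9 6) /\
      (8/3 * D T 9 10 <= D T 9 6) /\
      (1 * D T 9 8 <= D T 9 7) /\
      (4 * D T 9 10 <= D T 9 7).
Proof.
  destruct C9_exists as [C [hroot [happrox [hC hiso]]]].
  exists C; split; [assumption|split; [assumption|]]; intros T.
  assert (hC0 : 0 < C) by apply hroot.
  destruct (ravi T) as [x [y [z [hx [hy [hz [ea [eb ec]]]]]]]].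
  pose proof (D9_scaled_sq T x y z hx hy hz ea eb ec) as hsq.
  pose proof (expanding_bounds_hold x y z hx hy hz) as hb.
  pose proof (scaled_sq_10_5 x y z hx hy hz) as h10_5.
  pose proof (scaled_sq_6_5 C (conj (Rlt_le _ _ hC0) hC) hiso x y z hx hy hz)
    as h6_5.
  cbv zeta in hsq, h10_5, h6_5.
  assert (hxy : 0 < x*y) by now apply Rmult_lt_0_compat.
  assert (hyz : 0 < y*z) by now apply Rmult_lt_0_compat.
  assert (hzx : 0 < z*x) by now apply Rmult_lt_0_compat.
  assert (hxyz : 0 < x*y*z) by now apply Rmult_lt_0_compat.
  (* The first inequality gives [p*q + r >= 10*r], the source of the constant 10; the second gives
     [p^2 - q >= 2/3*p^2], the source of 2/3 between D(9,1) and D(9,6). *)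
  assert (hpq2 : 9*(x*y*z) <= (x + y + z)*(x*y + y*z + z*x)).
  { pose proof (pow2_ge_0 (x - y)). pose proof (pow2_ge_0 (y - z)).
    pose proof (pow2_ge_0 (z - x)). nra. }
  assert (hp3q : 3*(x*y + y*z + z*x) <= (x + y + z)^2).
  { pose proof (pow2_ge_0 (x - y)). pose proof (pow2_ge_0 (y - z)).
    pose proof (pow2_ge_0 (z - x)). nra. }
  assert (hp : 0 < x + y + z) by lra.
  assert (hq : 0 < x*y + y*z + z*x) by lra.
  set (p := x + y + z) in *. set (q := x*y + y*z + z*x) in *.
  set (r := x*y*z) in *.
  clearbody p q r; clear x y z hx hy hz ea eb ec hxy hyz hzx hroot happrox hiso.
  assert (hc : 0 < 64*p*q^2*r).
  { repeat apply Rmult_lt_0_compat; lra. }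
  assert (hdist : forall n, 0 <= D T 9 n) by (intros; apply pdist_nonneg).
  assert (cmp : forall i j k, (1 <= i <= 10)%nat -> i <> 9%nat ->
            (1 <= j <= 10)%nat -> j <> 9%nat ->
            k^2*scaled_sq i p q r <= scaled_sq j p q r ->
            k*D T 9 i <= D T 9 j).
  { intros i j k hi hi9 hj hj9.
    apply (le_of_scaled_sq _ _ _ _ _ _ hc (hdist j) (hsq i hi hi9) (hsq j hj hj9)). }
  assert (hpq0 : 0 < p^2 - q) by lra.
  assert (hsq6 : scaled_sq 6 p q r = p^4/(p^2 - q)^2*scaled_sq 1 p q r)
    by (unfold scaled_sq; field; lra).
  assert (cmp6 : forall j k, (1 <= j <= 10)%nat -> j <> 9%nat ->
            k^2*(p^4*scaled_sq 1 p q r) <= (p^2 - q)^2*scaled_sq j p q r ->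
            k*D T 9 6 <= D T 9 j).
  { intros j k hj hj9 h. apply cmp; try lia. rewrite hsq6.
    apply (Rmult_le_reg_l ((p^2 - q)^2)); [now apply pow_lt|].
    eapply Rle_trans; [|exact h]. right; field; lra. }
  unfold expanding_bounds in hb.
  destruct hb as (h7_1 & h1_7 & h8_1 & h7_5 & h7_6 & h6_7 & h10_7 & h3_4 & h3_5
                  & h10_3 & h5_4 & h4_5 & h6_4).
  (* [scaled_sq 7] is exactly nine times [scaled_sq 2]; bounds on D(9,2) thus follow from bounds on
     D(9,7). *)
  assert (D T 9 7 = 3*D T 9 2).
  { apply Rle_antisym.
    - enough (1/3*D T 9 7 <= D T 9 2) by lra.
      apply cmp; try lia. unfold scaled_sq; lra.
    - apply cmp; try lia. unfold scaled_sq; lra. }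
  assert (1/2*D T 9 7 <= D T 9 1) by (apply cmp; lia || lra).
  assert (1*D T 9 1 <= D T 9 7) by (apply cmp; lia || lra).
  assert (1*D T 9 8 <= D T 9 1) by (apply cmp; lia || lra).
  assert (1/2*D T 9 7 <= D T 9 5) by (apply cmp; lia || lra).
  assert (4*D T 9 10 <= D T 9 7) by (apply cmp; lia || lra).
  assert (2*D T 9 3 <= D T 9 4) by (apply cmp; lia || lra).
  assert (1/2*D T 9 3 <= D T 9 5) by (apply cmp; lia || lra).
  assert (1*D T 9 10 <= D T 9 3) by (apply cmp; lia || lra).
  assert (2*D T 9 5 <= D T 9 4) by (apply cmp; lia || lra).
  assert (1/4*D T 9 4 <= D T 9 5) by (apply cmp; lia || lra).
  assert ((5/2 + sqrt 2)*D T 9 10 <= D T 9 5) by (apply cmp; lia || lra).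
  assert (1*D T 9 6 <= D T 9 4) by (apply cmp6; lia || lra).
  assert (C*D T 9 6 <= D T 9 5) by (apply cmp6; lia || lra).
  assert (3/4*D T 9 6 <= D T 9 7) by (apply cmp6; lia || lra).
  assert (hsq1 : 0 <= scaled_sq 1 p q r).
  { rewrite <- hsq by lia. apply Rmult_le_pos; [lra|apply pow2_ge_0]. }
  assert (2/3*D T 9 6 <= D T 9 1).
  { apply cmp6; try lia.
    enough (0 <= (9*(p^2 - q)^2 - 4*p^4)*scaled_sq 1 p q r) by lra.
    apply Rmult_le_pos; [nra|assumption]. }
  assert (1*D T 9 1 <= D T 9 6).
  { apply cmp; try lia. rewrite hsq6.
    enough (1 <= p^4/(p^2 - q)^2) by nra.
    apply (Rmult_le_reg_r ((p^2 - q)^2)); [now apply pow_lt|].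
    field_simplify; [nra|lra]. }
  assert (2/3*D T 9 7 <= D T 9 6).
  { apply cmp; try lia. rewrite hsq6.
    apply (Rmult_le_reg_l ((p^2 - q)^2)); [now apply pow_lt|].
    replace ((p^2 - q)^2*(p^4/(p^2 - q)^2*scaled_sq 1 p q r))
      with (p^4*scaled_sq 1 p q r) by (field; lra).
    lra. }
  (* Both scaled squares share the factor [q^2 - 3*p*r], whose sign is read off from D(9,10)^2 >=
     0. *)
  assert (10*D T 9 10 <= D T 9 4).
  { apply cmp; try lia.
    assert (0 <= scaled_sq 10 p q r).
    { rewrite <- hsq by lia. apply Rmult_le_pos; [lra|apply pow2_ge_0]. }
    assert (h : (10*r)^2 <= (p*q + r)^2) by (apply pow_incr; lra).
    assert (0 < r^2) by now apply pow_lt.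
    unfold scaled_sq in *.
    assert (0 <= q^2 - 3*p*r)
      by (apply (Rmult_le_reg_l (16*r^2)); [lra|]; now rewrite Rmult_0_r).
    apply (Rmult_le_compat_r (16*(q^2 - 3*p*r))) in h; lra. }
  pose proof (hdist 1%nat). pose proof (hdist 6%nat).
  pose proof (hdist 7%nat). pose proof (hdist 10%nat).
  (* The remaining bounds are linear chains of those above, such as D(9,8) <= D(9,1) <= D(9,6) <=
     D(9,4). *)
  repeat split; lra.
Qed.
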